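(* Let $(M,g)$ be a Riemannian manifold with curvature tensor $R$, and let $p\in M$. (1) If there is $k(p)>0$ such that for all linearly independent $X,Y\in T_pM$ $$\frac{k(p)}{4}\le \frac{R(X,Y,X,Y)}{|X\wedge Y|^2}\le k(p),$$ then $R(Z,W,\overline Z,\overline W)\ge0$ for all $Z,W\in T_pM\otimes\mathbb{C}$. (2) If there are $k(p)>0$ and $\delta>0$ such that for all linearly independent $X,Y\in T_pM$ $$\frac{1+\delta}{4}k(p)\le \frac{R(X,Y,X,Y)}{|X\wedge Y|^2}\le (1-\delta)k(p),$$ then there exists $\epsilon>0$ such that $(R-\epsilon\,\mathrm{I})(Z,W,\overline Z,\overline W)\ge0$ for all $Z,W\in T_pM\otimes\mathbb{C}$.
   Context: The metric $\langle\cdot,\cdot\rangle$ is extended to a symmetric $\mathbb{C}$-bilinear (not Hermitian) form on $TM\otimes\mathbb{C}$ and the curvature tensor $R$ is extended $\mathbb{C}$-linearly; $R(Z,W,\overline Z,\overline W)=\langle R(Z,W)\overline Z,\overline W\rangle$. Sign convention: for real linearly independent $X,Y$ the sectional curvature is $R(X,Y,X,Y)/|X\wedge Y|^2$, where $|X\wedge Y|^2=|X|^2|Y|^2-\langle X,Y\rangle^2$. $\mathrm{I}$ is the ($\mathbb{C}$-linear extension of the) identity element of $S^2(\wedge^2 T_pM)$, i.e. the algebraic curvature tensor of constant sectional curvature $1$: $\mathrm{I}(Z,W,\overline Z,\overline W)=\langle Z,\overline Z\rangle\langle W,\overline W\rangle-|\langle Z,\overline W\rangle|^2$. *)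

(* Defs.v *)
From HB Require Import structures.
From mathcomp Require Import all_boot all_order all_algebra.
From mathcomp Require Import all_classical all_reals all_analysis.
From mathcomp Require Import complex.

Set Implicit Arguments.
Unset Strict Implicit.
Unset Printing Implicit Defensive.

Import Order.TTheory GRing.Theory Num.Theory.
Import numFieldNormedType.Exports.

Local Open Scope classical_set_scope.
Local Open Scope ring_scope.
Local Open Scope complex_scope.

Definition coord_vec (R : realType) (n : nat) (i : 'I_n) : 'rV[R]_n :=
  delta_mx ord0 i.

Definition partial (R : realType) (n : nat) (i : 'I_n) (f : 'rV[R]_n -> R) :
  'rV[R]_n -> R := 'D_(coord_vec R i) f.

(* C^infinity on an open set U: every iterated partial derivative, of any order
   and in any sequence of directions, is Frechet differentiable on U. *)
Definition smooth_on (R : realType) (n : nat) (U : set 'rV[R]_n)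
    (f : 'rV[R]_n -> R) : Prop :=
  forall s : seq 'I_n, forall x, U x ->
    differentiable (foldr (@partial R n) f s) x.

Record chart (R : realType) (n : nat) (M : topologicalType) := Chart {
  chart_dom : set M;
  chart_coord : M -> 'rV[R]_n;
  chart_inv : 'rV[R]_n -> M;
  chart_dom_open : open chart_dom;
  chart_img_open : open (chart_coord @` chart_dom);
  chart_coordK : forall p, chart_dom p -> chart_inv (chart_coord p) = p;
  chart_coord_cont : forall p, chart_dom p -> {for p, continuous chart_coord};
  chart_inv_cont : forall x, (chart_coord @` chart_dom) x ->
    {for x, continuous chart_inv}
}.

(* The change of coordinates from c to d, defined on chart_overlap c d. *)
Definition transition (R : realType) (n : nat) (M : topologicalType)
  (c d : chart R n M) : 'rV[R]_n -> 'rV[R]_n := chart_coord d \o chart_inv c.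

Definition chart_overlap (R : realType) (n : nat) (M : topologicalType)
    (c d : chart R n M) : set 'rV[R]_n :=
  chart_coord c @` (chart_dom c `&` chart_dom d).

(* The metric is given by its matrices g_ij in the charts of the atlas; tangent
   vectors are rows, transforming by v |-> v *m 'J (transition c d) x. *)
Record riemannian_manifold (R : realType) (n : nat) := RiemannianManifold {
  carrier :> topologicalType;
  carrier_hausdorff : hausdorff_space carrier;
  carrier_second_countable : @second_countable carrier;
  atlas : set (chart R n carrier);
  atlas_cover : forall p, exists2 c, atlas c & chart_dom c p;
  atlas_smooth : forall c d, atlas c -> atlas d ->
    forall j, smooth_on (chart_overlap c d)
                        (fun x => transition c d x ord0 j);
  metric : chart R n carrier -> 'rV[R]_n -> 'M[R]_n;
  metric_smooth : forall c, atlas c ->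
    forall i j, smooth_on (chart_coord c @` chart_dom c)
                          (fun x => metric c x i j);
  metric_sym : forall c, atlas c -> forall x,
    (chart_coord c @` chart_dom c) x -> (metric c x)^T = metric c x;
  metric_pos : forall c, atlas c -> forall x,
    (chart_coord c @` chart_dom c) x ->
    forall v : 'rV[R]_n, v != 0 -> 0 < (v *m metric c x *m v^T) ord0 ord0;
  metric_change : forall c d, atlas c -> atlas d -> forall x,
    chart_overlap c d x ->
    let J := jacobian (transition c d) x in
    metric c x = J *m metric d (transition c d x) *m J^T
}.

(* Gamma^k_ij of the Levi-Civita connection of the metric g. *)
Definition christoffel (R : realType) (n : nat) (g : 'rV[R]_n -> 'M[R]_n)
    (i j k : 'I_n) (x : 'rV[R]_n) : R :=
  2^-1 * \sum_(l < n) invmx (g x) k l *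
    (partial i (fun y => g y j l) x + partial j (fun y => g y i l) x
     - partial l (fun y => g y i j) x).

Definition covariant_derivative (R : realType) (n : nat)
    (g : 'rV[R]_n -> 'M[R]_n) (X Y : 'rV[R]_n -> 'rV[R]_n) (x : 'rV[R]_n) :
    'rV[R]_n :=
  \row_k (\sum_(i < n) X x ord0 i * partial i (fun y => Y y ord0 k) x
          + \sum_(i < n) \sum_(j < n)
              christoffel g i j k x * X x ord0 i * Y x ord0 j).

Definition coord_field (R : realType) (n : nat) (i : 'I_n) :
  'rV[R]_n -> 'rV[R]_n := fun=> coord_vec R i.

(* R(d_i, d_j) d_k with the sign convention
   R(X, Y) Z = nabla_Y nabla_X Z - nabla_X nabla_Y Z + nabla_[X, Y] Z,
   which makes <R(X, Y) X, Y> the (unnormalized) sectional curvature;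
   coordinate fields commute, so the bracket term vanishes. *)
Definition curvature_field (R : realType) (n : nat) (g : 'rV[R]_n -> 'M[R]_n)
    (i j k : 'I_n) (x : 'rV[R]_n) : 'rV[R]_n :=
  let nabla := covariant_derivative g in
  let d := @coord_field R n in
  nabla (d j) (nabla (d i) (d k)) x - nabla (d i) (nabla (d j) (d k)) x.

Definition tensor4 (R : realType) (n : nat) := 'I_n -> 'I_n -> 'I_n -> 'I_n -> R.

Definition eval4 (K : pzRingType) (n : nat)
    (T : 'I_n -> 'I_n -> 'I_n -> 'I_n -> K) (X Y U V : 'rV[K]_n) : K :=
  \sum_(i < n) \sum_(j < n) \sum_(k < n) \sum_(l < n)
    T i j k l * X ord0 i * Y ord0 j * U ord0 k * V ord0 l.

(* C-multilinear extension to T_pM (x) C. *)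
Definition evalC (R : realType) (n : nat) (T : tensor4 R n)
    (X Y U V : 'rV[R[i]]_n) : R[i] :=
  eval4 (fun i j k l => (T i j k l)%:C) X Y U V.

Definition conj_vec (R : realType) (n : nat) (Z : 'rV[R[i]]_n) : 'rV[R[i]]_n :=
  map_mx (@conjc R) Z.

(* T_pM is identified with 'rV[R]_n through the coordinate basis of a chart c
   around p; the following are components in that basis. *)
Definition metric_at (R : realType) (n : nat) (M : riemannian_manifold R n)
    (c : chart R n M) (p : M) : 'M[R]_n := metric c (chart_coord c p).

Definition inner (R : realType) (n : nat) (M : riemannian_manifold R n)
    (c : chart R n M) (p : M) (X Y : 'rV[R]_n) : R :=
  (X *m metric_at c p *m Y^T) ord0 ord0.

Definition curvature (R : realType) (n : nat) (M : riemannian_manifold R n)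
    (c : chart R n M) (p : M) : tensor4 R n :=
  fun i j k l =>
    inner c p (curvature_field (metric c) i j k (chart_coord c p))
              (coord_vec R l).

(* The identity of S^2(wedge^2 T_pM), of constant sectional curvature 1. *)
Definition unit_curvature (R : realType) (n : nat)
    (M : riemannian_manifold R n) (c : chart R n M) (p : M) : tensor4 R n :=
  fun i j k l => let g := metric_at c p in g i k * g j l - g i l * g j k.

Definition wedge_sqnorm (R : realType) (n : nat) (M : riemannian_manifold R n)
    (c : chart R n M) (p : M) (X Y : 'rV[R]_n) : R :=
  inner c p X X * inner c p Y Y - inner c p X Y ^+ 2.

Definition sectional (R : realType) (n : nat) (M : riemannian_manifold R n)
    (c : chart R n M) (p : M) (X Y : 'rV[R]_n) : R :=
  eval4 (curvature c p) X Y X Y / wedge_sqnorm c p X Y.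

(* Main.v *)
(* At the point p the curvature components form an algebraic curvature tensor:
   with H_abce the second derivatives of the metric and Gamma_abm, Gamma_ab^m the
   Christoffel symbols of both kinds,
     R_ijkl = (H_jikl + H_jkil - H_jlik - H_ijkl - H_ikjl + H_iljk) / 2
              + sum_m (Gamma_jk^m Gamma_ilm - Gamma_ik^m Gamma_jlm),
   and the symmetries follow from those of H (Schwarz) and of the Christoffel
   symbols.
   The rest is linear algebra. Q(Z,W) = R(Z,W,conj Z,conj W) is multiplied by
   |det|^2 under a change of basis of span(Z,W), so by a Hermitian Gram-Schmidt
   step, a rotation and two phases one may assume that the real and imaginary
   parts X, Y, U, V of Z = X + iY and W = U + iV are pairwise orthogonal. Then
     Q(Z,W) = R(X,U,X,U) + R(X,V,X,V) + R(Y,U,Y,U) + R(Y,V,Y,V) - 2 R(X,Y,U,V),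
   where the first four terms are at least k/4 (|X|^2+|Y|^2)(|U|^2+|V|^2) in total
   and Berger's inequality bounds the last one by k |X||Y||U||V|.
   Part (2) is part (1) applied to R - epsilon I, with epsilon = 2 delta k / 3. *)

Require Import Defs.
From HB Require Import structures.
From mathcomp Require Import all_boot all_order all_algebra.
From mathcomp Require Import all_classical all_reals all_analysis.
From mathcomp Require Import complex.
From mathcomp Require Import ring lra.

Set Implicit Arguments.
Unset Strict Implicit.
Unset Printing Implicit Defensive.

Import Order.TTheory GRing.Theory Num.Theory.
Import numFieldNormedType.Exports.

Local Open Scope ring_scope.

(** * Algebraic curvature tensors *)

Section Eval4.
Variables (K : comNzRingType) (n : nat).
Implicit Types (T : 'I_n -> 'I_n -> 'I_n -> 'I_n -> K) (X Y U V : 'rV[K]_n).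

Lemma eval4_swap12 T X Y U V :
  eval4 T X Y U V = eval4 (fun i j => T j i) Y X U V.
Proof.
rewrite /eval4 exchange_big; do 4 apply: eq_bigr => ? _; ring.
Qed.

Lemma eval4_swap23 T X Y U V :
  eval4 T X Y U V = eval4 (fun i j k => T i k j) X U Y V.
Proof.
rewrite /eval4; apply: eq_bigr => ? _; rewrite exchange_big.
by do 3 apply: eq_bigr => ? _; ring.
Qed.

Lemma eval4_swap34 T X Y U V :
  eval4 T X Y U V = eval4 (fun i j k l => T i j l k) X Y V U.
Proof.
rewrite /eval4; do 2 apply: eq_bigr => ? _; rewrite exchange_big.
by do 2 apply: eq_bigr => ? _; ring.
Qed.

Lemma eval4_lin1 T a X X' Y U V :
  eval4 T (a *: X + X') Y U V = a * eval4 T X Y U V + eval4 T X' Y U V.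
Proof.
rewrite /eval4; do 4 (rewrite mulr_sumr -big_split; apply: eq_bigr => ? _).
by rewrite !mxE /=; ring.
Qed.

Lemma eval4_lin2 T a X Y Y' U V :
  eval4 T X (a *: Y + Y') U V = a * eval4 T X Y U V + eval4 T X Y' U V.
Proof.
by rewrite eval4_swap12 eval4_lin1; congr (_ * _ + _);
  rewrite [RHS]eval4_swap12.
Qed.

Lemma eval4_lin3 T a X Y U U' V :
  eval4 T X Y (a *: U + U') V = a * eval4 T X Y U V + eval4 T X Y U' V.
Proof.
by rewrite eval4_swap23 eval4_lin2; congr (_ * _ + _);
  rewrite [RHS]eval4_swap23.
Qed.

Lemma eval4_lin4 T a X Y U V V' :
  eval4 T X Y U (a *: V + V') = a * eval4 T X Y U V + eval4 T X Y U V'.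
Proof.
by rewrite eval4_swap34 eval4_lin3; congr (_ * _ + _);
  rewrite [RHS]eval4_swap34.
Qed.

Lemma eval4_zero1 T Y U V : eval4 T 0 Y U V = 0.
Proof. by do 4 apply: big1 => ? _; rewrite mxE !(mulr0, mul0r). Qed.

Lemma eval4_zero2 T X U V : eval4 T X 0 U V = 0.
Proof. by do 4 apply: big1 => ? _; rewrite mxE !(mulr0, mul0r). Qed.

Lemma eval4_zero3 T X Y V : eval4 T X Y 0 V = 0.
Proof. by do 4 apply: big1 => ? _; rewrite mxE !(mulr0, mul0r). Qed.

Lemma eval4_zero4 T X Y U : eval4 T X Y U 0 = 0.
Proof. by do 4 apply: big1 => ? _; rewrite mxE !(mulr0, mul0r). Qed.

Lemma eval4_scale T a b c d X Y U V :
  eval4 T (a *: X) (b *: Y) (c *: U) (d *: V) = a * b * c * d * eval4 T X Y U V.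
Proof.
rewrite /eval4; do 4 (rewrite mulr_sumr; apply: eq_bigr => ? _).
by rewrite !mxE; ring.
Qed.

Lemma eval4D T T' X Y U V :
  eval4 (fun i j k l => T i j k l + T' i j k l) X Y U V
  = eval4 T X Y U V + eval4 T' X Y U V.
Proof.
rewrite /eval4; do 4 (rewrite -big_split; apply: eq_bigr => ? _).
by rewrite /=; ring.
Qed.

Lemma eval4Z T a X Y U V :
  eval4 (fun i j k l => a * T i j k l) X Y U V = a * eval4 T X Y U V.
Proof.
rewrite /eval4; do 4 (rewrite mulr_sumr; apply: eq_bigr => ? _).
by rewrite !mulrA.
Qed.

Lemma eval4N T X Y U V :
  eval4 (fun i j k l => - T i j k l) X Y U V = - eval4 T X Y U V.
Proof.
by rewrite -mulN1r -eval4Z; do 4 apply: eq_bigr => ? _; rewrite mulN1r.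
Qed.

Lemma eq_eval4 T T' X Y U V :
  (forall i j k l, T i j k l = T' i j k l) ->
  eval4 T X Y U V = eval4 T' X Y U V.
Proof. by move=> e; do 4 apply: eq_bigr => ? _; rewrite e. Qed.

Definition curvature_like T :=
  [/\ forall i j k l, T j i k l = - T i j k l,
      forall i j k l, T i j l k = - T i j k l &
      forall i j k l, T i j k l + T j k i l + T k i j l = 0].

Section CurvatureLike.
Variable (T : 'I_n -> 'I_n -> 'I_n -> 'I_n -> K).
Hypothesis T_curv : curvature_like T.
Local Notation r := (eval4 T).

Lemma eval4_anti12 X Y U V : r Y X U V = - r X Y U V.
Proof.
case: T_curv => h _ _.
by rewrite eval4_swap12 -eval4N; apply: eq_eval4 => *; rewrite h.
Qed.

Lemma eval4_anti34 X Y U V : r X Y V U = - r X Y U V.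
Proof.
case: T_curv => _ h _.
by rewrite eval4_swap34 -eval4N; apply: eq_eval4 => *; rewrite h.
Qed.

Lemma eval4_bianchi X Y U V : r X Y U V + r Y U X V + r U X Y V = 0.
Proof.
case: T_curv => _ _ h.
rewrite (eval4_swap23 _ Y U) (eval4_swap12 _ Y X).
rewrite (eval4_swap12 _ U X) (eval4_swap23 _ X U) -!eval4D.
by do 4 apply: big1 => ? _; rewrite h !mul0r.
Qed.

End CurvatureLike.
End Eval4.

(** * Pair symmetry and polarization of algebraic curvature tensors *)

Section RealCurvature.
Variables (R : realFieldType) (n : nat) (T : 'I_n -> 'I_n -> 'I_n -> 'I_n -> R).
Hypothesis T_curv : curvature_like T.
Implicit Types X Y U V : 'rV[R]_n.
Local Notation r := (eval4 T).

(** Octahedron argument: in the sum of the four Bianchi identities beginning at each of the four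
    vectors, antisymmetry cancels everything but twice the difference of the two sides. *)
Lemma eval4_pair_sym X Y U V : r U V X Y = r X Y U V.
Proof.
have h12 := eval4_anti12 T_curv; have h34 := eval4_anti34 T_curv.
have := eval4_bianchi T_curv X Y U V; have := eval4_bianchi T_curv Y U V X.
have := eval4_bianchi T_curv U V X Y; have := eval4_bianchi T_curv V X Y U.
rewrite (h34 V X U Y) (h34 X Y U V) (h12 V Y X U) (h34 U V X Y).
rewrite (h34 Y U X V) (h34 V Y X U) (h12 U X V Y) (h34 U X Y V).
lra.
Qed.

(** The left side is the sum over signs [a], [b] of [a * b] times the curvature of [X + a V],
    [Y + b U]. Only the terms odd in both signs survive; pair symmetry groups the four of them in
    twos. *)
Lemma eval4_polarize X Y U V :
  r (X + V) (Y + U) (X + V) (Y + U) + r (X - V) (Y - U) (X - V) (Y - U)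
  - r (X + V) (Y - U) (X + V) (Y - U) - r (X - V) (Y + U) (X - V) (Y + U)
  = 8 * (r X Y V U + r X U V Y).
Proof.
have lin1 a := eval4_lin1 T a; have lin2 a := eval4_lin2 T a.
have lin3 a := eval4_lin3 T a; have lin4 a := eval4_lin4 T a.
rewrite -[V]scale1r -[U]scale1r -!scaleNr ![X + _]addrC ![Y + _]addrC.
rewrite !lin1 !lin2 !lin3 !lin4 !scale1r.
have := eval4_pair_sym X Y V U; have := eval4_pair_sym X U V Y.
lra.
Qed.

End RealCurvature.

(** * Bilinear forms given by a matrix *)

Section BilinearForm.
Variables (K : comNzRingType) (n : nat) (g : 'M[K]_n).
Implicit Types X Y Z U V : 'rV[K]_n.

Definition bform X Y : K := (X *m g *m Y^T) ord0 ord0.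

Lemma bform_lin1 a X Y Z : bform (a *: X + Y) Z = a * bform X Z + bform Y Z.
Proof. by rewrite /bform !mulmxDl -!scalemxAl !mxE. Qed.

Lemma bform_lin2 a X Y Z : bform Z (a *: X + Y) = a * bform Z X + bform Z Y.
Proof. by rewrite /bform linearD linearZ /= mulmxDr -scalemxAr !mxE. Qed.

Lemma bformZ a b X Y : bform (a *: X) (b *: Y) = a * b * bform X Y.
Proof. by rewrite /bform linearZ /= -!scalemxAl -!scalemxAr scalerA !mxE. Qed.

Lemma bform0l X : bform 0 X = 0.
Proof. by rewrite /bform !mul0mx mxE. Qed.

Lemma bform0r X : bform X 0 = 0.
Proof. by rewrite /bform trmx0 mulmx0 mxE. Qed.

Lemma bform_comb a b c d X Y U V :
  bform (a *: X + b *: Y) (c *: U + d *: V)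
  = a * c * bform X U + a * d * bform X V + b * c * bform Y U + b * d * bform Y V.
Proof.
rewrite bform_lin1 -[b *: Y]addr0 bform_lin1 -[d *: V]addr0 !bform_lin2.
by rewrite !bform0l !bform0r; ring.
Qed.

Lemma bform_sym : g^T = g -> forall X Y, bform X Y = bform Y X.
Proof.
by move=> gT X Y; rewrite /bform -[X *m _ *m _]trmxK mxE !trmx_mul trmxK gT mulmxA.
Qed.

Lemma bform_sum X Y :
  bform X Y = \sum_(i < n) \sum_(j < n) g i j * X ord0 i * Y ord0 j.
Proof.
rewrite /bform mxE; under eq_bigr do rewrite !mxE mulr_suml.
by rewrite exchange_big; do 2 apply: eq_bigr => ? _; ring.
Qed.

End BilinearForm.

Definition pos_def (R : realFieldType) n (g : 'M[R]_n) :=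
  g^T = g /\ forall v : 'rV[R]_n, v != 0 -> 0 < bform g v v.

(** * Berger's inequality and orthogonal real frames *)

Section PinchedCurvature.
Variables (R : rcfType) (n : nat) (T : 'I_n -> 'I_n -> 'I_n -> 'I_n -> R).
Variables (g : 'M[R]_n) (k : R).
Implicit Types X Y U V : 'rV[R]_n.
Local Notation r := (eval4 T).
Local Notation bform := (bform g).
Definition wedge X Y := bform X X * bform Y Y - bform X Y ^+ 2.
Hypothesis T_curv : curvature_like T.
Hypothesis g_pos : pos_def g.
Hypothesis T_pinched : forall X Y,
  k / 4 * wedge X Y <= r X Y X Y <= k * wedge X Y.

(** Polarization bounds both R(X,Y,U,V) - R(U,X,Y,V) and R(X,Y,U,V) - R(Y,U,X,V) by 3k/4. By Bianchi
    their sum is 3 R(X,Y,U,V). *)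
Lemma berger_inequality X Y U V :
    bform X X = 1 -> bform Y Y = 1 -> bform U U = 1 -> bform V V = 1 ->
    bform X Y = 0 -> bform X U = 0 -> bform X V = 0 ->
    bform Y U = 0 -> bform Y V = 0 -> bform U V = 0 ->
  2 * r X Y U V <= k.
Proof.
move=> XX YY UU VV XY XU XV YU YV UV.
have gC := bform_sym g_pos.1.
(* For signs [a], [b] the squared area is 4, so each curvature in the polarization formula lies
   between k and 4k. *)
have wE a b X' V' Y' U' : bform X' X' = 1 -> bform Y' Y' = 1 ->
    bform U' U' = 1 -> bform V' V' = 1 -> bform X' Y' = 0 -> bform X' U' = 0 ->
    bform X' V' = 0 -> bform V' Y' = 0 -> bform Y' U' = 0 -> bform V' U' = 0 ->
    wedge (a *: V' + X') (b *: U' + Y') = (a ^+ 2 + 1) * (b ^+ 2 + 1).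
  move=> h1 h2 h3 h4 h5 h6 h7 h8 h9 h10.
  rewrite /wedge !bform_lin1 !bform_lin2 (gC V' X') (gC U' Y').
  by rewrite h1 h2 h3 h4 h5 h6 h7 h8 h9 h10; ring.
have b a b' := T_pinched (a *: V + X) (b' *: U + Y).
have c a b' := T_pinched (a *: U + X) (b' *: V + Y).
have := b 1 1; have := b 1 (-1); have := b (-1) 1; have := b (-1) (-1).
have := c 1 1; have := c 1 (-1); have := c (-1) 1; have := c (-1) (-1).
have [VU UY VY] : [/\ bform V U = 0, bform U Y = 0 & bform V Y = 0].
  by rewrite gC UV gC YU gC YV.
rewrite !wE //.
rewrite !scaleN1r !scale1r ![_ + X]addrC ![_ + Y]addrC.
have := eval4_polarize T_curv X Y U V; have := eval4_polarize T_curv X Y V U.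
have h12 := eval4_anti12 T_curv; have h34 := eval4_anti34 T_curv.
rewrite (h34 X Y U V) (h12 U X V Y) (h34 U X Y V).
rewrite (eval4_pair_sym T_curv U Y X V) (h12 Y U X V).
have := eval4_bianchi T_curv X Y U V.
lra.
Qed.

(** The bounds give r <= k * wedge <= 4 r, hence 3 r >= 0, whatever the sign of [k]. *)
Lemma sectional_term_ge0 X Y : 0 <= r X Y X Y.
Proof. by have := T_pinched X Y; lra. Qed.

Lemma orthogonal_frame_ge0 X Y U V :
    bform X Y = 0 -> bform X U = 0 -> bform X V = 0 ->
    bform Y U = 0 -> bform Y V = 0 -> bform U V = 0 ->
  0 <= r X U X U + r X V X V + r Y U Y U + r Y V Y V - 2 * r X Y U V.
Proof.
move=> XY XU XV YU YV UV.
have lin1 a := eval4_lin1 T a; have lin2 a := eval4_lin2 T a.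
have lin3 a := eval4_lin3 T a; have lin4 a := eval4_lin4 T a.
(* If one vector vanishes, so does the mixed term, and the other four are nonnegative. This leaves
   nonzero vectors, which can be normalized. *)
have r0 : X = 0 \/ Y = 0 \/ U = 0 \/ V = 0 -> r X Y U V = 0.
  by case=> [->|[->|[->|->]]];
    rewrite ?(eval4_zero1, eval4_zero2, eval4_zero3, eval4_zero4).
have s1 := sectional_term_ge0 X U; have s2 := sectional_term_ge0 X V.
have s3 := sectional_term_ge0 Y U; have s4 := sectional_term_ge0 Y V.
have [X0|X0] := eqVneq X 0; first by rewrite r0; [lra|left].
have [Y0|Y0] := eqVneq Y 0; first by rewrite r0; [lra|right; left].
have [U0|U0] := eqVneq U 0; first by rewrite r0; [lra|right; right; left].
have [V0|V0] := eqVneq V 0; first by rewrite r0; [lra|right; right; right].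
move=> {r0 s1 s2 s3 s4}.
have unit A : A != 0 -> exists2 a, 0 < a & exists2 E, A = a *: E & bform E E = 1.
  move=> /(g_pos.2) A0; exists (Num.sqrt (bform A A)); first by rewrite sqrtr_gt0.
  have a0 : Num.sqrt (bform A A) != 0 by rewrite gt_eqF ?sqrtr_gt0.
  exists ((Num.sqrt (bform A A))^-1 *: A); first by rewrite scalerA divff ?scale1r.
  rewrite bformZ -[X in _ * _ * X]sqr_sqrtr ?ltW// expr2; field; exact: a0.
have [x x0 [E1 eX n1]] := unit X X0; have [y y0 [E2 eY n2]] := unit Y Y0.
have [u u0 [E3 eU n3]] := unit U U0; have [v v0 [E4 eV n4]] := unit V V0.
have orth a b A B :
    bform (a *: A) (b *: B) = 0 -> 0 < a -> 0 < b -> bform A B = 0.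
  move=> /eqP + a0 b0; rewrite bformZ !mulf_eq0 (gt_eqF a0) (gt_eqF b0) /= => /eqP //.
move: XY XU XV YU YV UV; rewrite {}eX {}eY {}eU {}eV.
move=> /orth/(_ x0 y0) ? /orth/(_ x0 u0) ? /orth/(_ x0 v0) ?.
move=> /orth/(_ y0 u0) ? /orth/(_ y0 v0) ? /orth/(_ u0 v0) ?.
rewrite !eval4_scale.
have berger : 2 * r E1 E2 E3 E4 <= k by apply: berger_inequality.
have sec A B : bform A A = 1 -> bform B B = 1 -> bform A B = 0 ->
    k / 4 <= r A B A B <= k.
  by move=> a b c; have := T_pinched A B; rewrite /wedge a b c expr0n mulr1 subr0 !mulr1.
have := sec E1 E3 ltac:(assumption) ltac:(assumption) ltac:(assumption).
have := sec E1 E4 ltac:(assumption) ltac:(assumption) ltac:(assumption).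
have := sec E2 E3 ltac:(assumption) ltac:(assumption) ltac:(assumption).
have := sec E2 E4 ltac:(assumption) ltac:(assumption) ltac:(assumption).
(* What remains is an inequality between real numbers: the lengths [x], [y], [u], [v] and five
   curvature values. *)
move: (r E1 E3 _ _) (r E1 E4 _ _) (r E2 E3 _ _) (r E2 E4 _ _) (r E1 E2 _ _) berger.
move=> a b c d e he /andP[h1 _] /andP[h2 _] /andP[h3 _] /andP[h4 h5].
have k0 : 0 <= k by lra.
have m1 : k / 4 * (x * u) ^+ 2 <= a * (x * u) ^+ 2 by rewrite ler_wpM2r ?sqr_ge0.
have m2 : k / 4 * (x * v) ^+ 2 <= b * (x * v) ^+ 2 by rewrite ler_wpM2r ?sqr_ge0.
have m3 : k / 4 * (y * u) ^+ 2 <= c * (y * u) ^+ 2 by rewrite ler_wpM2r ?sqr_ge0.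
have m4 : k / 4 * (y * v) ^+ 2 <= d * (y * v) ^+ 2 by rewrite ler_wpM2r ?sqr_ge0.
have m5 : 2 * e * (x * y * u * v) <= k * (x * y * u * v).
  by rewrite ler_wpM2r // !mulr_ge0 // ltW.
(* (x^2 + y^2)(u^2 + v^2) - 4xyuv is the sum of the squares of xu - yv and xv - yu. *)
have m6 : 0 <= k * (x * u - y * v) ^+ 2 by rewrite mulr_ge0 ?sqr_ge0.
have m7 : 0 <= k * (x * v - y * u) ^+ 2 by rewrite mulr_ge0 ?sqr_ge0.
lra.
Qed.

End PinchedCurvature.

(** * Choice of phases and of the rotation parameter *)

Section ComplexNumbers.
Variable R : rcfType.
Local Open Scope complex_scope.

Lemma mulcJ (z : R[i]) : z * conjc z = (complex.Re z ^+ 2 + complex.Im z ^+ 2)%:C.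
Proof.
by case: z => x y; apply/eqP; rewrite eq_complex /=; apply/andP; split;
  apply/eqP; ring.
Qed.

Lemma sqnorm_gt0 (z : R[i]) :
  z != 0 -> 0 < complex.Re z ^+ 2 + complex.Im z ^+ 2.
Proof.
case: z => x y; rewrite eq_complex /= => xy0.
by rewrite lt0r addr_ge0 ?sqr_ge0 // paddr_eq0 ?sqr_ge0 // !sqrf_eq0 xy0.
Qed.

(** For [l] the conjugate of a square root of [z], [l ^+ 2 * z] is the squared modulus of [z]. *)
Lemma exists_phase_real (z : R[i]) :
  exists2 l : R[i], l != 0 & complex.Im (l ^+ 2 * z) = 0.
Proof.
have [->|z0] := eqVneq z 0; first by exists 1; rewrite ?oner_eq0 ?mulr0 ?raddf0.
exists (conjc (sqrtc z)); first by rewrite conjc_eq0 sqrtc_eq0.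
rewrite -rmorphXn /= sqr_sqrtc; case: z {z0} => x y /=. ring.
Qed.

(* Write [t = r * s] with [r] real. The phase [s] is chosen so that
   [hW * a * conjc s - hZ * d * s] is a real multiple [c * b] of [b]; what
   remains is [hZ - r ^+ 2 * |s| ^+ 2 * hW = r * c], a real quadratic equation
   in [r] with discriminant [c ^+ 2 + 4 * |s| ^+ 2 * hW * hZ > 0]. *)
Lemma exists_diagonalizing_rotation (a b d : R[i]) (hZ hW : R) :
  0 < hZ -> 0 < hW ->
  exists t : R[i],
    hZ%:C * b - t * conjc t * hW%:C * b - conjc t * hW%:C * a + t * hZ%:C * d = 0.
Proof.
move=> hZ0 hW0.
have [->|b0] := eqVneq b 0; first by exists (0%R : R[i]); rewrite rmorph0; ring.
pose f (s : R[i]) := conjc s * hW%:C * a - s * hZ%:C * d.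
have [s s0 fs] : exists2 s : R[i], s != 0 & complex.Im (conjc b * f s) = 0.
  (* The imaginary part is a real linear form in [s], with values [m] at 1 and [n] at ['i]; it
     vanishes at n - m i. *)
  pose m := complex.Im (conjc b * f 1); pose n := complex.Im (conjc b * f 'i).
  have [m0|m0] := eqVneq m 0; first by exists 1; rewrite ?oner_eq0.
  exists (n -i* m); first by rewrite eq_complex /= oppr_eq0 (negbTE m0) andbF.
  rewrite /m /n /f; case: (a) (b) (d) => [a1 a2] [b1 b2] [d1 d2] /=; ring.
pose nb := complex.Re b ^+ 2 + complex.Im b ^+ 2.
have nb0 : nb != 0 by rewrite gt_eqF ?sqnorm_gt0.
have [c fc] : exists c : R, f s = c%:C * b.
  exists (complex.Re (conjc b * f s) / nb).
  have bb : conjc b * b = nb%:C by rewrite mulrC mulcJ.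
  apply: (@mulfI _ (conjc b)); first by rewrite conjc_eq0.
  rewrite mulrCA bb -rmorphM /= divfK // {1}[conjc b * f s]complexE fs.
  by rewrite mulr0 addr0.
pose q := complex.Re s ^+ 2 + complex.Im s ^+ 2.
have q0 : 0 < q by exact: sqnorm_gt0.
have ss : s * conjc s = q%:C by exact: mulcJ.
have [r hr] : exists r : R, hZ - r ^+ 2 * q * hW - r * c = 0.
  pose D := Num.sqrt (c ^+ 2 + 4 * q * hW * hZ).
  have DD : D ^+ 2 = c ^+ 2 + 4 * q * hW * hZ.
    by rewrite sqr_sqrtr // addr_ge0 ?sqr_ge0 // !mulr_ge0 // ltW.
  exists ((D - c) / (2 * q * hW)).
  have h : hW != 0 by rewrite gt_eqF.
  have h' : q != 0 by rewrite gt_eqF.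
  apply: (@mulfI _ (4 * q * hW)).
    by rewrite !mulf_neq0 // pnatr_eq0.
  rewrite mulr0; transitivity (c ^+ 2 + 4 * q * hW * hZ - D ^+ 2).
    by field; rewrite h h'.
  by rewrite DD subrr.
exists (r%:C * s); rewrite rmorphM /= oppr0 complexr0.
transitivity ((hZ - r ^+ 2 * q * hW - r * c)%:C * b); last by rewrite hr mul0r.
transitivity (hZ%:C * b - r%:C ^+ 2 * (s * conjc s) * hW%:C * b - r%:C * f s).
  by rewrite /f; ring.
by rewrite ss fc !(rmorphB, rmorphM, rmorphXn) /=; ring.
Qed.

End ComplexNumbers.

(** * Complex sectional curvature *)

Section Alternating.
Variables (K : numFieldType) (n : nat) (T : 'I_n -> 'I_n -> 'I_n -> 'I_n -> K).
Hypothesis T_curv : curvature_like T.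
Implicit Types Z W U V : 'rV[K]_n.

Lemma eval4_alt12 Z U V : eval4 T Z Z U V = 0.
Proof.
have /eqP := eval4_anti12 T_curv Z Z U V.
by rewrite -addr_eq0 -mulr2n mulrn_eq0 /= => /eqP.
Qed.

Lemma eval4_alt34 Z U V : eval4 T U V Z Z = 0.
Proof.
have /eqP := eval4_anti34 T_curv U V Z Z.
by rewrite -addr_eq0 -mulr2n mulrn_eq0 /= => /eqP.
Qed.

Lemma eval4_det12 a b c d Z W U V :
  eval4 T (a *: Z + b *: W) (c *: Z + d *: W) U V
  = (a * d - b * c) * eval4 T Z W U V.
Proof.
rewrite -[b *: W]addr0 -[d *: W]addr0 !eval4_lin1 !eval4_lin2 !eval4_alt12.
rewrite (eval4_anti12 T_curv Z W).
by rewrite !eval4_zero1 !eval4_zero2; ring.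
Qed.

Lemma eval4_det34 a b c d Z W U V :
  eval4 T U V (a *: Z + b *: W) (c *: Z + d *: W)
  = (a * d - b * c) * eval4 T U V Z W.
Proof.
rewrite -[b *: W]addr0 -[d *: W]addr0 !eval4_lin3 !eval4_lin4 !eval4_alt34.
rewrite (eval4_anti34 T_curv U V Z W).
by rewrite !eval4_zero3 !eval4_zero4; ring.
Qed.

End Alternating.

(** * Complexified tangent vectors *)

Section ComplexVectors.
Variables (R : realType) (n : nat).
Local Open Scope complex_scope.

Definition toC (X : 'rV[R]_n) : 'rV[R[i]]_n := map_mx (real_complex R) X.

Lemma conj_vec_lin a (Z W : 'rV[R[i]]_n) :
  conj_vec (a *: Z + W) = conjc a *: conj_vec Z + conj_vec W.
Proof. by apply/matrixP => i j; rewrite !mxE rmorphD rmorphM. Qed.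

Lemma conj_vec_comb a b (Z W : 'rV[R[i]]_n) :
  conj_vec (a *: Z + b *: W) = conjc a *: conj_vec Z + conjc b *: conj_vec W.
Proof. by apply/matrixP => i j; rewrite !mxE rmorphD !rmorphM. Qed.

Lemma conj_vecK (Z : 'rV[R[i]]_n) : conj_vec (conj_vec Z) = Z.
Proof. by apply/matrixP => i j; rewrite !mxE conjcK. Qed.

Lemma conj_vec_real X : conj_vec (toC X) = toC X.
Proof. by apply/matrixP => i j; rewrite !mxE conjc_real. Qed.

Lemma complex_vecP (Z : 'rV[R[i]]_n) :
  exists X, exists Y, Z = 'i *: toC Y + toC X.
Proof.
exists (map_mx (@complex.Re R) Z), (map_mx (@complex.Im R) Z).
by apply/matrixP => i j; rewrite !mxE addrC -complexE.
Qed.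

Lemma evalC_real (T : tensor4 R n) X Y U V :
  evalC T (toC X) (toC Y) (toC U) (toC V) = (eval4 T X Y U V)%:C.
Proof.
rewrite /evalC /eval4; do 4 (rewrite rmorph_sum /=; apply: eq_bigr => ? _).
by rewrite !mxE !rmorphM.
Qed.

Variable g : 'M[R]_n.
(** The complex bilinear extension of [g]; the Hermitian product of Z and W is
    [bformC Z (conj_vec W)]. *)
Definition bformC : 'rV[R[i]]_n -> 'rV[R[i]]_n -> R[i] :=
  bform (map_mx (real_complex R) g).

Lemma bformC_real X Y : bformC (toC X) (toC Y) = (bform g X Y)%:C.
Proof. by rewrite /bformC /bform /toC map_trmx -!map_mxM mxE. Qed.

Lemma bformC_lin1 a Z Z' W :
  bformC (a *: Z + Z') W = a * bformC Z W + bformC Z' W.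
Proof. exact: bform_lin1. Qed.

Lemma bformC_lin2 a Z Z' W :
  bformC W (a *: Z + Z') = a * bformC W Z + bformC W Z'.
Proof. exact: bform_lin2. Qed.

Lemma bformC_comb a b c d Z W Z' W' :
  bformC (a *: Z + b *: W) (c *: Z' + d *: W')
  = a * c * bformC Z Z' + a * d * bformC Z W' + b * c * bformC W Z'
    + b * d * bformC W W'.
Proof. exact: bform_comb. Qed.

Lemma bformCZ a b Z W : bformC (a *: Z) (b *: W) = a * b * bformC Z W.
Proof. exact: bformZ. Qed.

Lemma bformC_conj Z W : bformC (conj_vec Z) (conj_vec W) = conjc (bformC Z W).
Proof.
set h := map_mx (real_complex R) g.
have hE : h = map_mx (@conjc R) h by apply/matrixP => i j; rewrite !mxE conjc_real.
by rewrite /bformC -/h {1}hE /bform /conj_vec map_trmx -!map_mxM mxE.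
Qed.

End ComplexVectors.

(** * Nonnegativity under quarter pinching *)

Section PinchedComplex.
Variables (R : realType) (n : nat) (T : tensor4 R n) (g : 'M[R]_n) (k : R).
Hypothesis T_curv : curvature_like T.
Hypothesis g_pos : pos_def g.
Hypothesis T_pinched : forall X Y,
  k / 4 * wedge g X Y <= eval4 T X Y X Y <= k * wedge g X Y.
Local Open Scope complex_scope.
Implicit Types (X Y U V : 'rV[R]_n) (Z W : 'rV[R[i]]_n).
Local Notation B := (bformC g).

Definition complex_sectional Z W := evalC T Z W (conj_vec Z) (conj_vec W).
Local Notation Q := complex_sectional.

Lemma bformC_sym Z W : B Z W = B W Z.
Proof. by apply: bform_sym; rewrite map_trmx g_pos.1. Qed.

(** Pair symmetry cancels the imaginary part and reduces the mixed real terms to 2 (R(Y,U,X,V) -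
    R(X,U,Y,V)), which is -2 R(X,Y,U,V) by Bianchi. *)
Lemma complex_sectionalE X Y U V :
  Q ('i *: toC Y + toC X) ('i *: toC V + toC U)
  = (eval4 T X U X U + eval4 T X V X V + eval4 T Y U Y U + eval4 T Y V Y V
     - 2 * eval4 T X Y U V)%:C.
Proof.
rewrite /complex_sectional !conj_vec_lin !conj_vec_real /evalC.
rewrite !eval4_lin1 !eval4_lin2 !eval4_lin3 !eval4_lin4.
have evalE A A' C C' : eval4 (fun i j k l => (T i j k l)%:C)
    (toC A) (toC A') (toC C) (toC C') = (eval4 T A A' C C')%:C.
  exact: evalC_real.
rewrite !evalE.
have h12 := eval4_anti12 T_curv; have h34 := eval4_anti34 T_curv.
have hp := eval4_pair_sym T_curv.
have b := eval4_bianchi T_curv X Y U V.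
have e1 := hp X U X V; have e2 := hp X U Y U; have e3 := hp X U Y V.
have e4 := hp X V Y U; have e5 := hp X V Y V; have e6 := hp Y U Y V.
have e7 := h12 U X Y V.
by apply/eqP; rewrite eq_complex /=; apply/andP; split; apply/eqP; lra.
Qed.

(** The first two slots contribute the determinant of the base change and the last two its
    conjugate, so [Q] is multiplied by a positive real number. *)
Lemma complex_sectional_basis a b c d Z W :
  a * d - b * c != 0 -> 0 <= Q (a *: Z + b *: W) (c *: Z + d *: W) ->
  0 <= Q Z W.
Proof.
set D := _ - _ => D0.
have TC_curv : curvature_like (fun i j k l => (T i j k l)%:C).
  have [h1 h2 h3] := T_curv; split=> i j k' l.
  - by rewrite h1 rmorphN.
  - by rewrite h2 rmorphN.
  - by rewrite -!rmorphD h3.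
rewrite /complex_sectional /evalC !conj_vec_comb eval4_det12 // eval4_det34 //.
rewrite -!rmorphM -rmorphB -/D mulrA mulcJ pmulr_rge0 //.
by rewrite ltcR sqnorm_gt0.
Qed.

Lemma complex_sectional0 Z W : Z = 0 \/ W = 0 -> 0 <= Q Z W.
Proof.
by rewrite /complex_sectional /evalC => -[]->; rewrite ?eval4_zero1 ?eval4_zero2.
Qed.

(** The first two conditions say that X is orthogonal to Y and U to V. The real and imaginary parts
    of the other two make X and Y orthogonal to U and V. *)
Lemma complex_sectional_orthogonal_frame Z W :
  complex.Im (B Z Z) = 0 -> complex.Im (B W W) = 0 ->
  B Z W = 0 -> B Z (conj_vec W) = 0 -> 0 <= Q Z W.
Proof.
have [X [Y ->]] := complex_vecP Z; have [U [V ->]] := complex_vecP W.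
rewrite complex_sectionalE conj_vec_lin !conj_vec_real.
rewrite !bformC_lin1 !bformC_lin2 !bformC_real.
rewrite (bform_sym g_pos.1 Y X) (bform_sym g_pos.1 V U).
move=> h1 h2 [h3 h4] [h5 h6]; move: h1 h2 h3 h4 h5 h6 => /=.
move=> h1 h2 h3 h4 h5 h6.
rewrite ler0c; by apply: (orthogonal_frame_ge0 T_curv g_pos T_pinched); lra.
Qed.

(** Rescaling Z and W by complex factors makes B(Z,Z) and B(W,W) real and keeps both orthogonality
    relations. *)
Lemma complex_sectional_orthogonal Z W :
  B Z W = 0 -> B Z (conj_vec W) = 0 -> 0 <= Q Z W.
Proof.
move=> ZW ZcW.
have [l l0 hl] := exists_phase_real (B Z Z).
have [m m0 hm] := exists_phase_real (B W W).
apply: (@complex_sectional_basis l 0 0 m).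
  by rewrite mul0r subr0 mulf_neq0.
rewrite !scale0r addr0 add0r.
have conjZ : conj_vec (m *: W) = conjc m *: conj_vec W.
  by apply/matrixP => i j; rewrite !mxE rmorphM.
by apply: complex_sectional_orthogonal_frame;
  rewrite ?conjZ bformCZ -?expr2 ?ZW ?ZcW ?mulr0.
Qed.

Lemma hermitian_norm Z : Z != 0 -> exists2 h : R, 0 < h & B Z (conj_vec Z) = h%:C.
Proof.
have [X [Y ->]] := complex_vecP Z => XY0.
exists (bform g X X + bform g Y Y).
  have ge0 A : 0 <= bform g A A.
    have [->|/g_pos.2/ltW//] := eqVneq A 0; by rewrite bform0l.
  have [X0|/g_pos.2 X0] := eqVneq X 0; last by rewrite ltr_wpDr.
  rewrite ltr_wpDl // g_pos.2 //; apply: contra_neq XY0 => ->.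
  by rewrite X0 /toC map_mx0 scaler0 addr0.
rewrite conj_vec_lin !conj_vec_real.
rewrite !bformC_lin1 !bformC_lin2 !bformC_real.
rewrite (bform_sym g_pos.1 Y X).
by apply/eqP; rewrite eq_complex /=; apply/andP; split; apply/eqP; ring.
Qed.

(** The basis Z + tW, -conj(t) hW Z + hZ W is Hermitian orthogonal for every t, and its determinant
    hZ + |t|^2 hW is positive. The parameter t is chosen to annihilate the bilinear product as
    well. *)
Lemma complex_sectional_hermitian_orthogonal Z W :
  Z != 0 -> W != 0 -> B Z (conj_vec W) = 0 -> 0 <= Q Z W.
Proof.
move=> /hermitian_norm[hZ hZ0 ZZ] /hermitian_norm[hW hW0 WW] ZcW.
have WcZ : B W (conj_vec Z) = 0.
  by rewrite -[W]conj_vecK bformC_conj bformC_sym ZcW rmorph0.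
have [t ht] := exists_diagonalizing_rotation (B Z Z) (B Z W) (B W W) hZ0 hW0.
apply: (@complex_sectional_basis 1 t (- conjc t * hW%:C) hZ%:C).
  have -> : 1 * hZ%:C - t * (- conjc t * hW%:C)
      = (hZ + (complex.Re t ^+ 2 + complex.Im t ^+ 2) * hW)%:C.
    by rewrite rmorphD rmorphM /= -mulcJ; ring.
  by rewrite gt_eqF // ltcR ltr_wpDr // mulr_ge0 ?addr_ge0 ?sqr_ge0 // ltW.
apply: complex_sectional_orthogonal.
- by rewrite -ht bformC_comb (bformC_sym W Z); ring.
- rewrite conj_vec_comb bformC_comb ZZ WW ZcW WcZ rmorphM rmorphN /= conjcK.
  by rewrite !oppr0 !complexr0; ring.
Qed.

Theorem pinched_complex_sectional_ge0 Z W : 0 <= Q Z W.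
Proof.
have [Z0|Z0] := eqVneq Z 0; first by apply: complex_sectional0; left.
have [h h0 ZZ] := hermitian_norm Z0.
(* Gram-Schmidt coefficient: [c *: Z + W] is Hermitian orthogonal to Z. *)
pose c := - (B W (conj_vec Z) / h%:C).
apply: (@complex_sectional_basis 1 0 c 1).
  by rewrite mul0r mulr1 subr0 oner_eq0.
rewrite !scale1r scale0r addr0.
have [->|W0] := eqVneq (c *: Z + W) 0; first by apply: complex_sectional0; right.
apply: complex_sectional_hermitian_orthogonal => //.
rewrite -[Z]conj_vecK bformC_conj conj_vecK bformC_sym bformC_lin1.
rewrite ZZ /c mulNr divfK ?addNr ?rmorph0 //.
by rewrite gt_eqF // ltcR.
Qed.

End PinchedComplex.

(** * Symmetry of second derivatives *)

Section SymmetryOfSecondDerivatives.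
Variables (R : realType) (V : normedModType R).
Implicit Types (f : V -> R) (x u v w : V).

(** Both derivatives are limits of one and the same difference quotient. *)
Lemma derive_along_line f x w (s : R) : derivable f (x + s *: w) w ->
  is_derive s 1 (fun t => f (x + t *: w)) ('D_w f (x + s *: w)).
Proof.
have quotE : (fun h : R => h^-1 *: (((fun t => f (x + t *: w)) \o shift s) (h *: 1)
      - f (x + s *: w)))
    = (fun h => h^-1 *: ((f \o shift (x + s *: w)) (h *: w) - f (x + s *: w))).
  apply/funext => h /=; congr (_ *: (f _ - _)).
  by rewrite [h *: (1 : R)]mulr1 scalerDl addrCA.
move=> df; split; first by rewrite /derivable quotE.
by rewrite /derive quotE.
Qed.

Lemma derive_shift_arg f x u w :
  derivable f (x + u) w -> is_derive x w (fun y => f (y + u)) ('D_w f (x + u)).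
Proof.
have quotE : (fun h : R => h^-1 *: (((fun y => f (y + u)) \o shift x) (h *: w)
      - f (x + u)))
    = (fun h => h^-1 *: ((f \o shift (x + u)) (h *: w) - f (x + u))).
  by apply/funext => h /=; rewrite addrA.
move=> df; split; first by rewrite /derivable quotE.
by rewrite /derive quotE.
Qed.

Lemma MVT_line f x w (h : R) : 0 < h ->
  (forall s, 0 <= s <= h -> derivable f (x + s *: w) w) ->
  exists2 s, 0 <= s <= h & f (x + h *: w) - f x = 'D_w f (x + s *: w) * h.
Proof.
move=> h0 df.
have dF s : s \in `[0, h] ->
    is_derive s 1 (fun t => f (x + t *: w)) ('D_w f (x + s *: w)).
  by rewrite in_itv /= => sh; exact/derive_along_line/df.
pose F (t : R) := f (x + t *: w).
have F_cont : {within `[0, h], continuous F}%classic.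
  by apply: derivable_within_continuous => s /dF [].
have F_der s : s \in `]0, h[ -> is_derive s 1 F ('D_w f (x + s *: w)).
  by move=> sh; apply: dF; apply: subset_itv_oo_cc sh.
have [s sh] := MVT_segment (ltW h0) F_der F_cont.
by rewrite subr0 /F scale0r addr0 => E; exists s => //; rewrite in_itv in sh.
Qed.

(** The mean value theorem is applied along [u] to the increment f(y + hv) - f(y), then along [v] to
    ['D_u f]. *)
Lemma second_difference f x u v (h : R) : 0 < h ->
  (forall s t, 0 <= s <= h -> 0 <= t <= h ->
     derivable f (x + s *: u + t *: v) u /\
     derivable ('D_u f) (x + s *: u + t *: v) v) ->
  exists s t, [/\ 0 <= s <= h, 0 <= t <= h &
    f (x + h *: u + h *: v) - f (x + h *: u) - f (x + h *: v) + f x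
    = 'D_v ('D_u f) (x + s *: u + t *: v) * h * h].
Proof.
move=> h0 df.
have hh : 0 <= h <= h by rewrite lexx ltW.
have z0 : (0 : R) <= 0 <= h by rewrite lexx ltW.
pose F y := f (y + h *: v) - f y.
have dF s : 0 <= s <= h -> is_derive (x + s *: u) u F
    ('D_u f (x + s *: u + h *: v) - 'D_u f (x + s *: u)).
  move=> sh; apply: is_deriveB.
    by apply: derive_shift_arg; have [] := df s h sh hh.
  by apply: derivableP; have [+ _] := df s 0 sh z0; rewrite scale0r addr0.
have [s sh eF] := @MVT_line F x u h h0 (fun s sh => (@ex_derive _ _ _ _ _ _ _ (dF s sh))).
have [|t th eG] := @MVT_line ('D_u f) (x + s *: u) v h h0.
  by move=> t th; have [] := df s t sh th.
exists s, t; split=> //.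
transitivity (F (x + h *: u) - F x); first by rewrite /F; ring.
by rewrite eF (@derive_val _ _ _ _ _ _ _ (dF s sh)) eG.
Qed.

Lemma near_parallelogram (P : V -> Prop) x u v : (\forall y \near x, P y) ->
  exists2 h : R, 0 < h &
    forall s t, 0 <= s <= h -> 0 <= t <= h -> P (x + s *: u + t *: v).
Proof.
move=> /nbhs_ballP[e /= e0 eP].
have d0 : 0 < `|u| + `|v| + 1 by rewrite ltr_wpDl ?addr_ge0.
(* The summand 1 keeps the denominator positive when u = v = 0 and makes the final bound strict. *)
exists (e / (`|u| + `|v| + 1)); first by rewrite divr_gt0.
move=> s t /andP[s0 sh] /andP[t0 th]; apply: eP.
rewrite -ball_normE /ball_ /= -addrA opprD addrA subrr add0r normrN.
rewrite (le_lt_trans (ler_normD _ _)) // !normrZ (ger0_norm s0) (ger0_norm t0).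
set q := e / _ in sh th.
have q0 : 0 < q by rewrite divr_gt0.
have -> : e = q * (`|u| + `|v| + 1) by rewrite /q divfK // gt_eqF.
rewrite !mulrDr mulr1 ltr_pwDr // lerD // ler_wpM2r //.
Qed.

Lemma derive_comm f x u v :
  (\forall y \near x, derivable f y u /\ derivable ('D_u f) y v) ->
  (\forall y \near x, derivable f y v /\ derivable ('D_v f) y u) ->
  {for x, continuous ('D_v ('D_u f))} -> {for x, continuous ('D_u ('D_v f))} ->
  'D_v ('D_u f) x = 'D_u ('D_v f) x.
Proof.
have close (a b c d : R) : `|a - c| < d / 2 -> `|b - c| < d / 2 -> `|a - b| <= d.
  by rewrite !ltr_norml ler_norml; lra.
move=> duv dvu cuv cvu.
apply/eqP; rewrite -subr_eq0 -normr_le0; apply/ler_addgt0Pl => e e0.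
have e20 : 0 < e / 2 by rewrite divr_gt0.
have nuv : \forall y \near x, `|'D_v ('D_u f) x - 'D_v ('D_u f) y| < e / 2.
  exact: (@cvgr_dist_lt _ _ _ _ _ _ _ cuv (e/2)).
have nvu : \forall y \near x, `|'D_u ('D_v f) x - 'D_u ('D_v f) y| < e / 2.
  exact: (@cvgr_dist_lt _ _ _ _ _ _ _ cvu (e/2)).
have [h h0 H] := near_parallelogram u v (filterI (filterI duv dvu) (filterI nuv nvu)).
have [|s [t [sh th E1]]] := @second_difference f x u v h h0.
  by move=> s t sh th; have [[]] := H s t sh th.
have [|t' [s' [th' sh' E2]]] := @second_difference f x v u h h0.
  by move=> t' s' th' sh'; rewrite addrAC; have [[]] := H s' t' sh' th'.
have [_ [c1 _]] := H s t sh th; have [_ [_ c2]] := H s' t' sh' th'.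
have E : 'D_v ('D_u f) (x + s *: u + t *: v) = 'D_u ('D_v f) (x + t' *: v + s' *: u).
  have hn : h != 0 by rewrite gt_eqF.
  apply: (mulIf hn); apply: (mulIf hn).
  have swap (a b c d : R) : a - b - c + d = a - c - b + d by ring.
  apply: etrans (esym E1) _; apply: etrans E2; apply: etrans (swap _ _ _ _) _.
  by congr (f _ - _ - _ + _); apply: addrAC.
rewrite [x + t' *: v + _]addrAC in E; rewrite E in c1.
by rewrite addr0; apply: close c1 c2.
Qed.

End SymmetryOfSecondDerivatives.

(** * Symmetries of the Riemann tensor *)

Section DerivableMatrixInverse.
Variables (R : realType) (V : normedModType R) (x v : V).

Lemma derivable_bigsum (I : Type) (r : seq I) (F : I -> V -> R) :
  (forall i, derivable (F i) x v) ->
  derivable (fun y => \sum_(i <- r) F i y) x v.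
Proof.
move=> dF; elim: r => [|i r IH].
  by under eq_fun do rewrite big_nil; exact: derivable_cst.
under eq_fun do rewrite big_cons.
exact: derivableD (dF i) IH.
Qed.

Lemma derivable_bigprod (I : Type) (r : seq I) (F : I -> V -> R) :
  (forall i, derivable (F i) x v) ->
  derivable (fun y => \prod_(i <- r) F i y) x v.
Proof.
move=> dF; elim: r => [|i r IH].
  by under eq_fun do rewrite big_nil; exact: derivable_cst.
under eq_fun do rewrite big_cons.
exact: derivableM (dF i) IH.
Qed.

Lemma derivable_det n (M : V -> 'M[R]_n) :
  (forall i j, derivable (fun y => M y i j) x v) ->
  derivable (fun y => \det (M y)) x v.
Proof.
move=> dM; rewrite /determinant; apply: derivable_bigsum => s.
apply: derivableM; first exact: derivable_cst.
by apply: derivable_bigprod => i; exact: dM.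
Qed.

Lemma derivable_invmx n (M : V -> 'M[R]_n) :
  (\forall y \near x, M y \in unitmx) ->
  (forall i j, derivable (fun y => M y i j) x v) ->
  forall i j, derivable (fun y => invmx (M y) i j) x v.
Proof.
move=> Mu dM i j.
(* Cramer's formula describes [invmx] on invertible matrices only, so the equality is one of germs
   at [x]. *)
have E : \forall y \near x, (\det (M y))^-1 * cofactor (M y) j i = invmx (M y) i j.
  by apply: filterS Mu => y My; rewrite /invmx My !mxE.
apply: near_eq_derivable E _.
apply: derivableM.
  apply: derivableV; last exact: derivable_det.
  by rewrite -unitfE -unitmxE; exact: nbhs_singleton Mu.
rewrite /cofactor; apply: derivableM; first exact: derivable_cst.
by apply: derivable_det => a b; under eq_fun do rewrite !mxE; exact: dM.
Qed.

End DerivableMatrixInverse.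

(** A vector [v] of the left kernel satisfies g(v,v) = 0. *)
Lemma pos_def_unitmx (R : realFieldType) n (g : 'M[R]_n) :
  pos_def g -> g \in unitmx.
Proof.
move=> [_ g_pos]; rewrite -row_free_unit -kermx_eq0; apply/rowV0P => v.
move=> /sub_kermxP vg; apply/eqP; apply: contraT => /g_pos.
by rewrite /bform vg mul0mx mxE ltxx.
Qed.

(** * Partial derivatives of smooth functions on an open set *)

Section SmoothFunctions.
Variables (R : realType) (n : nat) (U : set 'rV[R]_n).
Hypothesis U_open : open U.
Implicit Types (f : 'rV[R]_n -> R) (x : 'rV[R]_n).

Lemma smooth_on_partial f i : smooth_on U f -> smooth_on U (partial i f).
Proof. by move=> fs s; rewrite -foldr_rcons; apply: fs. Qed.

Lemma smooth_on_derivable f x v : smooth_on U f -> U x -> derivable f x v.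
Proof. by move=> fs Ux; apply: diff_derivable; exact: (fs [::]). Qed.

Lemma near_open (P : 'rV[R]_n -> Prop) x :
  U x -> (forall y, U y -> P y) -> \forall y \near x, P y.
Proof. by move=> Ux UP; apply: filterS (open_nbhs_nbhs (conj U_open Ux)). Qed.

(** A derivative depends only on the germ. This allows differentiating identities known only on the
    image of a chart. *)
Lemma eq_partial f f' i x : (forall y, U y -> f y = f' y) -> U x ->
  partial i f x = partial i f' x.
Proof. by move=> ff' Ux; apply: near_eq_derive; exact: near_open. Qed.

Lemma partial_comm f i j x : smooth_on U f -> U x ->
  partial i (partial j f) x = partial j (partial i f) x.
Proof.
move=> fs Ux.
have ds k l : \forall y \near x, derivable f y (coord_vec R k) /\
    derivable ('D_(coord_vec R k) f) y (coord_vec R l).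
  apply: near_open => // y Uy; split; first exact: smooth_on_derivable.
  by apply: smooth_on_derivable Uy; exact: smooth_on_partial.
have cs k l : {for x, continuous ('D_(coord_vec R k) ('D_(coord_vec R l) f))}.
  apply: differentiable_continuous.
  exact: (@smooth_on_partial (partial l f) k (@smooth_on_partial f l fs) [::] x Ux).
exact: derive_comm.
Qed.

End SmoothFunctions.

(** The combinatorial core: [H] stands for the second partial derivatives of the metric and [q] for
    the products of Christoffel symbols. *)
Lemma curvature_like_of_symmetries (R : realFieldType) (n : nat)
    (H q : 'I_n -> 'I_n -> 'I_n -> 'I_n -> R) :
  (forall a b c e, H a b c e = H b a c e) ->
  (forall a b c e, H a b c e = H a b e c) ->
  (forall a b c e, q a b c e = q b a c e) ->
  (forall a b c e, q a b c e = q c e a b) ->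
  curvature_like (fun i j k l =>
    2^-1 * (H j i k l + H j k i l - H j l i k - H i j k l - H i k j l + H i l j k)
    + q j k i l - q i k j l).
Proof.
move=> Hab Hcd qs qw; split=> i j k l.
- by ring.
- rewrite (Hcd j i l k) (Hcd i j l k) (Hab i j k l) (qw j l i k) (qw i l j k).
  by ring.
- rewrite (Hcd j l k i) (Hcd k l j i) (Hcd i l k j).
  by rewrite (qs k j i l) (qs k i j l) (qs j i k l); ring.
Qed.

(** * The Levi-Civita connection in coordinates *)

Section LeviCivita.
Variables (R : realType) (n : nat) (g : 'rV[R]_n -> 'M[R]_n).
Variable U : set 'rV[R]_n.
Hypothesis U_open : open U.
Hypothesis g_smooth : forall i j, smooth_on U (fun y => g y i j).
Hypothesis g_pos : forall y, U y -> pos_def (g y).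
Local Notation d := (@partial R n).

Let g_sym i j y : U y -> g y i j = g y j i.
Proof. by move=> /g_pos[gT _]; rewrite -[in LHS]gT mxE. Qed.

(** Christoffel symbols of the first kind, the lowered index being the last one. *)
Definition christoffel1 (i j l : 'I_n) (y : 'rV[R]_n) : R :=
  2^-1 * (d i (fun y => g y j l) y + d j (fun y => g y i l) y
          - d l (fun y => g y i j) y).

Lemma christoffel_lower i j m y : U y ->
  \sum_k christoffel g i j k y * g y k m = christoffel1 i j m y.
Proof.
move=> Uy; have gu := pos_def_unitmx (g_pos Uy).
transitivity (\sum_l (\sum_k g y m k * invmx (g y) k l) * christoffel1 i j l y).
  under [RHS]eq_bigr do rewrite mulr_suml.
  rewrite exchange_big; apply: eq_bigr => k _ /=.
  rewrite /christoffel mulr_sumr mulr_suml; apply: eq_bigr => l _.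
  by rewrite /christoffel1 (g_sym k m Uy); ring.
have inv l : \sum_k g y m k * invmx (g y) k l = (m == l)%:R.
  by have := congr1 (fun A : 'M[R]_n => A m l) (mulmxV gu); rewrite !mxE.
under eq_bigr do rewrite inv.
rewrite (bigD1 m) //= eqxx mul1r big1 ?addr0 // => l /negbTE.
by rewrite eq_sym => ->; rewrite mul0r.
Qed.

(** Compatibility of the connection with the metric, in coordinates. *)
Lemma christoffel1_metric i k l y : U y ->
  christoffel1 i k l y + christoffel1 i l k y = d i (fun y => g y k l) y.
Proof.
move=> Uy; rewrite /christoffel1.
rewrite (eq_partial (f := fun y => g y l k) (f' := fun y => g y k l) U_open i _ Uy);
  last by move=> z; exact: g_sym.
by field.
Qed.

Lemma derivable_christoffel i j k x v : U x ->
  derivable (christoffel g i j k) x v.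
Proof.
move=> Ux; have dg a b c : derivable (d a (fun y => g y b c)) x v.
  by apply: smooth_on_derivable Ux; apply: smooth_on_partial.
apply: derivableM; first exact: derivable_cst.
apply: derivable_bigsum => l; apply: derivableM; last first.
  by apply: derivableB => //; apply: derivableD.
apply: derivable_invmx => [|a b]; last by apply: smooth_on_derivable Ux.
by apply: (near_open U_open Ux) => y /g_pos /pos_def_unitmx.
Qed.

Lemma covariant_derivative_coord j Y x m :
  covariant_derivative g (@coord_field R n j) Y x ord0 m
  = d j (fun y => Y y ord0 m) x
    + \sum_b christoffel g j b m x * Y x ord0 b.
Proof.
rewrite !mxE (bigD1 j) //= !mxE !eqxx mul1r big1 ?addr0 => [|i /negbTE ij]; last first.
  by rewrite !mxE ij mul0r.
congr (_ + _); rewrite (bigD1 j) //= [X in _ + X]big1 ?addr0 => [|i /negbTE ij].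
  by apply: eq_bigr => b _; rewrite !mxE !eqxx mulr1.
by apply: big1 => b _; rewrite !mxE ij mulr0 mul0r.
Qed.

Lemma covariant_derivative_coord2 j i k x m :
  covariant_derivative g (@coord_field R n j)
    (covariant_derivative g (@coord_field R n i) (@coord_field R n k)) x ord0 m
  = d j (christoffel g i k m) x
    + \sum_b christoffel g j b m x * christoffel g i k b x.
Proof.
have E y b : covariant_derivative g (@coord_field R n i) (@coord_field R n k) y ord0 b
    = christoffel g i k b y.
  rewrite covariant_derivative_coord /coord_field.
  rewrite /partial derive_cst add0r (bigD1 k) //= !mxE !eqxx mulr1.
  by rewrite big1 ?addr0 // => c /negbTE ck; rewrite !mxE ck mulr0.
rewrite covariant_derivative_coord; under eq_bigr do rewrite E.
by congr (d j _ x + _); apply/funext => y; rewrite E.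
Qed.

(** On [U] this is the inner product of nabla_a d_b and nabla_c d_e, whence its symmetries. *)
Definition quadratic_term (a b c e : 'I_n) (x : 'rV[R]_n) : R :=
  \sum_m christoffel g a b m x * christoffel1 c e m x.

Lemma christoffel_symm i j k y : U y -> christoffel g i j k y = christoffel g j i k y.
Proof.
move=> Uy; congr (_ * _); apply: eq_bigr => l _; congr (_ * (_ - _)).
  by rewrite addrC.
by apply: (eq_partial U_open) Uy => z; exact: g_sym.
Qed.

Lemma quadratic_term_symm a b c e x : U x ->
  quadratic_term a b c e x = quadratic_term b a c e x.
Proof. by move=> Ux; apply: eq_bigr => m _; rewrite (@christoffel_symm a). Qed.

Lemma quadratic_term_swap a b c e x : U x ->
  quadratic_term a b c e x = quadratic_term c e a b x.
Proof.
move=> Ux; rewrite /quadratic_term.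
under eq_bigr do rewrite -christoffel_lower // mulr_sumr.
under [RHS]eq_bigr do rewrite -christoffel_lower // mulr_sumr.
rewrite exchange_big; do 2 apply: eq_bigr => ? _.
by rewrite (g_sym _ _ Ux); ring.
Qed.

(** The product rule for the connection: <nabla_j nabla_i d_k, d_l> = d_j <nabla_i d_k, d_l> -
    <nabla_i d_k, nabla_j d_l>. *)
Lemma second_covariant_derivative_lower j i k l x : U x ->
  \sum_m (d j (christoffel g i k m) x
          + \sum_b christoffel g j b m x * christoffel g i k b x) * g x m l
  = d j (christoffel1 i k l) x - quadratic_term i k j l x.
Proof.
move=> Ux.
have dg m : derivable (fun y => g y m l) x (coord_vec R j).
  exact: smooth_on_derivable Ux.
(* The first-kind symbol is written as a contraction with [g] so that the product rule and metric
   compatibility apply. *)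
have -> : d j (christoffel1 i k l) x
    = d j (\sum_(m < n) (christoffel g i k m * (fun y => g y m l))) x.
  apply: (eq_partial U_open) Ux => y Uy.
  by rewrite fct_sumE -christoffel_lower.
rewrite /partial derive_sum => [|m]; last first.
  by apply: derivableM => //; apply: derivable_christoffel.
have chr m : derivable (christoffel g i k m) x (coord_vec R j).
  exact: derivable_christoffel.
have -> : \sum_m 'D_(coord_vec R j) (christoffel g i k m * (fun y => g y m l)) x
    = \sum_m (christoffel g i k m x * (christoffel1 j m l x + christoffel1 j l m x)
              + g x m l * d j (christoffel g i k m) x).
  by apply: eq_bigr => m _; rewrite (deriveM (chr m) (dg m)) christoffel1_metric.
have -> : \sum_m (d j (christoffel g i k m) x
      + \sum_b christoffel g j b m x * christoffel g i k b x) * g x m l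
    = \sum_m (d j (christoffel g i k m) x * g x m l
              + christoffel g i k m x * christoffel1 j m l x).
  rewrite big_split /=.
  under [X in _ = _ + X]eq_bigr do rewrite -christoffel_lower // mulr_sumr.
  rewrite exchange_big /= -big_split /=; apply: eq_bigr => m _.
  by rewrite mulrDl mulr_suml; congr (_ + _); apply: eq_bigr => b _; ring.
by rewrite /quadratic_term -sumrB; apply: eq_bigr => m _; ring.
Qed.

Definition second_partial (a b c e : 'I_n) (x : 'rV[R]_n) : R :=
  d a (d b (fun y => g y c e)) x.

Lemma partial_christoffel1 j i k l x : U x ->
  d j (christoffel1 i k l) x
  = 2^-1 * (second_partial j i k l x + second_partial j k i l x
            - second_partial j l i k x).
Proof.
move=> Ux; have dg a b c : is_derive x (coord_vec R j) (d a (fun y => g y b c))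
    (second_partial j a b c x).
  apply: derivableP; apply: smooth_on_derivable Ux; exact: smooth_on_partial.
have := @is_deriveZ _ _ _ _ 2^-1 _ _ _
  (is_deriveB (is_deriveD (dg i k l) (dg k i l)) (dg l i k)).
by move=> [_ E]; exact: E.
Qed.

(** [curvature] unfolds to this when [g] is the metric in a chart and [x] the coordinates of the
    point. *)
Definition curvature_at (x : 'rV[R]_n) : tensor4 R n := fun i j k l =>
  bform (g x) (curvature_field g i j k x) (coord_vec R l).

Lemma bform_coord (h : 'M[R]_n) (v : 'rV[R]_n) l :
  bform h v (coord_vec R l) = \sum_m v ord0 m * h m l.
Proof. by rewrite /bform /coord_vec trmx_delta -colE !mxE. Qed.

Lemma curvature_atE x i j k l : U x ->
  curvature_at x i j k l
  = 2^-1 * (second_partial j i k l x + second_partial j k i l x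
            - second_partial j l i k x - second_partial i j k l x
            - second_partial i k j l x + second_partial i l j k x)
    + quadratic_term j k i l x - quadratic_term i k j l x.
Proof.
move=> Ux; rewrite /curvature_at bform_coord.
under eq_bigr do rewrite mxE [X in _ + X]mxE !covariant_derivative_coord2 mulrBl.
rewrite sumrB !second_covariant_derivative_lower // !partial_christoffel1 //.
have ringE (c1 c2 c3 c4 c5 c6 p q : R) :
    2^-1 * (c1 + c2 - c3) - q - (2^-1 * (c4 + c5 - c6) - p)
    = 2^-1 * (c1 + c2 - c3 - c4 - c5 + c6) + p - q by ring.
exact: ringE.
Qed.

Lemma curvature_at_curvature_like x : U x -> curvature_like (curvature_at x).
Proof.
move=> Ux.
have Hab a b c e : second_partial a b c e x = second_partial b a c e x.
  exact: (partial_comm U_open).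
have Hcd a b c e : second_partial a b c e x = second_partial a b e c x.
  apply: (eq_partial U_open) Ux => y Uy; apply: (eq_partial U_open) Uy => z.
  exact: g_sym.
have qs a b c e := @quadratic_term_symm a b c e x Ux.
have qw a b c e := @quadratic_term_swap a b c e x Ux.
have [h1 h2 h3] := curvature_like_of_symmetries Hab Hcd qs qw.
by split=> i j k l; rewrite !curvature_atE.
Qed.

End LeviCivita.

(** * Pinching *)

Lemma curvature_likeB (K : comNzRingType) (n : nat)
    (T T' : 'I_n -> 'I_n -> 'I_n -> 'I_n -> K) (a : K) :
  curvature_like T -> curvature_like T' ->
  curvature_like (fun i j k l => T i j k l - a * T' i j k l).
Proof.
move=> [h1 h2 h3] [h1' h2' h3']; split=> i j k l.
- by rewrite h1 h1'; ring.
- by rewrite h2 h2'; ring.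
- transitivity ((T i j k l + T j k i l + T k i j l)
      - a * (T' i j k l + T' j k i l + T' k i j l)); first by ring.
  by rewrite h3 h3'; ring.
Qed.

(** * The tensor of constant curvature 1 and sectional bounds *)

Section UnitTensor.
Variables (R : realType) (n : nat) (g : 'M[R]_n).
Hypothesis g_pos : pos_def g.
Implicit Types X Y U V : 'rV[R]_n.

Definition unit_tensor : tensor4 R n :=
  fun i j k l => g i k * g j l - g i l * g j k.

Lemma unit_tensor_curvature_like : curvature_like unit_tensor.
Proof.
have gC i j : g i j = g j i by rewrite -[in LHS]g_pos.1 mxE.
split=> i j k l; rewrite /unit_tensor; [ring|ring|].
by rewrite (gC j i) (gC k j) (gC k i); ring.
Qed.

Lemma eval4_unit_tensor X Y U V :
  eval4 unit_tensor X Y U V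
  = bform g X U * bform g Y V - bform g X V * bform g Y U.
Proof.
rewrite (@eq_eval4 _ _ _ (fun i j k l => g i k * g j l + - (g i l * g j k))) //.
rewrite eval4D eval4N; congr (_ - _).
  (* Reordering the slots makes the fourfold sum a product of two double sums. *)
  rewrite eval4_swap23 /eval4 !bform_sum mulr_suml; apply: eq_bigr => i _.
  rewrite mulr_suml; apply: eq_bigr => k _; rewrite mulr_sumr.
  apply: eq_bigr => j _; rewrite mulr_sumr; apply: eq_bigr => l _; ring.
rewrite eval4_swap34 eval4_swap23 /eval4 !bform_sum mulr_suml.
apply: eq_bigr => i _; rewrite mulr_suml; apply: eq_bigr => k _.
rewrite mulr_sumr; apply: eq_bigr => j _; rewrite mulr_sumr.
by apply: eq_bigr => l _; ring.
Qed.

Lemma wedge_gt0 X Y : free [:: X; Y] -> 0 < wedge g X Y.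
Proof.
rewrite free_cons span_seq1 seq1_free => /andP[XY Y0].
have YY := g_pos.2 _ Y0.
(* [A] is g(Y,Y) times the component of X orthogonal to Y; its squared norm is g(Y,Y) times
   [wedge g X Y]. *)
pose A := bform g Y Y *: X + (- bform g X Y) *: Y.
have A0 : A != 0.
  apply: contra XY => /eqP A0; apply/vlineP; exists (bform g X Y / bform g Y Y).
  move: A0; rewrite /A scaleNr => /eqP; rewrite subr_eq0 => /eqP A0.
  by rewrite mulrC -scalerA -A0 scalerA mulVf ?scale1r // gt_eqF.
rewrite -(pmulr_rgt0 _ YY).
have -> : bform g Y Y * wedge g X Y = bform g A A; last exact: g_pos.2.
by rewrite bform_comb (bform_sym g_pos.1 Y X) /wedge; ring.
Qed.

(** For a free pair the positive denominator is cleared; for a dependent pair all three members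
    vanish. *)
Lemma pinched_of_sectional (T : tensor4 R n) (a b : R) : curvature_like T ->
  (forall X Y, free [:: X; Y] -> a <= eval4 T X Y X Y / wedge g X Y <= b) ->
  forall X Y, a * wedge g X Y <= eval4 T X Y X Y <= b * wedge g X Y.
Proof.
move=> T_curv T_sec X Y; have [XY|] := boolP (free [:: X; Y]).
  by have := T_sec X Y XY; rewrite ler_pdivlMr ?ler_pdivrMr ?wedge_gt0.
rewrite free_cons span_seq1 seq1_free negb_and !negbK => XY.
suff [-> ->] : eval4 T X Y X Y = 0 /\ wedge g X Y = 0 by rewrite !mulr0 lexx.
case/orP: XY => [/vlineP[s ->]|/eqP ->]; last first.
  by rewrite eval4_zero2 /wedge !bform0r expr0n mulr0 subr0.
split.
  have := eval4_det12 T_curv s 0 1 0 Y Y (s *: Y) Y.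
  by rewrite !scale0r !addr0 scale1r => ->; rewrite !mulr0 mul0r subr0 mul0r.
have := bformZ g s 1 Y Y; rewrite scale1r mulr1 => sYY.
by rewrite /wedge bformZ sYY; ring.
Qed.

End UnitTensor.

(** * Curvature at a point of the manifold *)

Section ManifoldCurvature.
Variables (R : realType) (n : nat) (M : riemannian_manifold R n).
Variables (p : M) (c : chart R n M).
Hypotheses (c_atlas : atlas c) (c_at_p : chart_dom c p).

Lemma metric_pos_def y :
  (chart_coord c @` chart_dom c)%classic y -> pos_def (metric c y).
Proof.
move=> cy; split; first exact: (Defs.metric_sym c_atlas cy).
exact: (Defs.metric_pos c_atlas cy).
Qed.

Lemma chart_coord_img : (chart_coord c @` chart_dom c)%classic (chart_coord c p).
Proof. by exists p. Qed.

Lemma curvature_curvature_like : curvature_like (curvature c p).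
Proof.
exact: (curvature_at_curvature_like (@chart_img_open _ _ _ c) (metric_smooth c_atlas)
  metric_pos_def chart_coord_img).
Qed.

End ManifoldCurvature.

Theorem proposition3p2 (R : realType) (n : nat) (M : riemannian_manifold R n)
    (p : M) (c : chart R n M) (c_atlas : atlas c) (c_at_p : chart_dom c p) :
  (forall k : R, 0 < k ->
     (forall X Y : 'rV[R]_n, free [:: X; Y] ->
        k / 4 <= sectional c p X Y <= k) ->
     forall Z W : 'rV[R[i]]_n,
       0 <= evalC (curvature c p) Z W (conj_vec Z) (conj_vec W)) /\
  (forall k delta : R, 0 < k -> 0 < delta ->
     (forall X Y : 'rV[R]_n, free [:: X; Y] ->
        (1 + delta) / 4 * k <= sectional c p X Y <= (1 - delta) * k) ->
     exists2 epsilon : R, 0 < epsilon &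
       forall Z W : 'rV[R[i]]_n,
         0 <= evalC (fun i j k l =>
                       curvature c p i j k l
                       - epsilon * unit_curvature c p i j k l)
                Z W (conj_vec Z) (conj_vec W)).
Proof.
have g_pos : pos_def (metric_at c p).
  exact: metric_pos_def c_atlas _ (chart_coord_img c_at_p).
have T_curv := curvature_curvature_like c_atlas c_at_p.
split=> [k _ /(pinched_of_sectional g_pos T_curv)|k delta k0 delta0
    /(pinched_of_sectional g_pos T_curv)] T_pinched.
  by move=> Z W; exact: (pinched_complex_sectional_ge0 T_curv g_pos T_pinched).
(* The largest value for which the lower bound (1 + delta) k / 4 - epsilon is at least a quarter of
   the upper bound (1 - delta) k - epsilon; equality holds here. *)
pose epsilon := 2 * delta * k / 3.
exists epsilon => [|Z W]; first by rewrite !mulr_gt0 ?invr_gt0.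
apply: (pinched_complex_sectional_ge0 (g := metric_at c p)
  (k := k - delta * k - epsilon)) => // [|X Y].
  exact: curvature_likeB T_curv (unit_tensor_curvature_like g_pos).
have -> : eval4 (fun i j m l => curvature c p i j m l
      - epsilon * unit_curvature c p i j m l) X Y X Y
    = eval4 (curvature c p) X Y X Y - epsilon * wedge (metric_at c p) X Y.
  rewrite eval4D eval4N eval4Z; congr (_ - _ * _).
  by rewrite [LHS]eval4_unit_tensor (bform_sym g_pos.1 Y X).
by have := T_pinched X Y; rewrite /epsilon; lra.
Qed.
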